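(* Let $(X,\mathcal{A})$ be a measurable space, let $\mu\colon\mathcal{A}\to[0,\infty]$ be a nonadditive measure, and let $0<q<\infty$. The following assertions are equivalent. (i) $\mu$ is monotone autocontinuous from below. (ii) For any $\{f_n\}_{n\in\mathbb{N}}\subset\mathcal{F}_0(X)$ and $f\in\mathcal{F}_0(X)$, if they satisfy (a) for each $n\in\mathbb{N}$ there is an $N_n\in\mathcal{A}$ such that $\mu(N_n)=0$ and $f_n(x)\le f_{n+1}(x)\le f(x)$ for every $x\notin N_n$, (b) $f_n\to f$ in $\mu$-measure, then $\mu(\{f_n>t\})\uparrow\mu(\{f>t\})$ for every continuity point $t$ of the function $t\mapsto\mu(\{f>t\})$. (iii) For any $\{f_n\}_{n\in\mathbb{N}}\subset\mathcal{F}_0^+(X)$ and $f\in\mathcal{F}_0^+(X)$, if they satisfy condition (a) and (c) $f_n\to f$ $\mu$-almost uniformly, then $\mathrm{Ch}(\mu,f_n^q)\uparrow\mathrm{Ch}(\mu,f^q)$.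
   Context: $X$ is a nonempty set and $\mathcal{A}$ is a $\sigma$-field of subsets of $X$. A nonadditive measure is a set function $\mu\colon\mathcal{A}\to[0,\infty]$ with $\mu(\emptyset)=0$ and $\mu(A)\le\mu(B)$ whenever $A,B\in\mathcal{A}$, $A\subset B$. $\mathcal{F}_0(X)$ is the set of all $\mathcal{A}$-measurable functions $X\to\mathbb{R}$ and $\mathcal{F}_0^+(X)$ is the subset of those with $f\ge 0$. Monotone autocontinuous from below: $\mu(A\setminus B_n)\to\mu(A)$ whenever $A,B_n\in\mathcal{A}$, $\{B_n\}_{n\in\mathbb{N}}$ is nonincreasing, and $\mu(B_n)\to 0$. $f_n\to f$ in $\mu$-measure: $\mu(\{|f_n-f|>\varepsilon\})\to 0$ for every $\varepsilon>0$. $f_n\to f$ $\mu$-almost uniformly: for any $\varepsilon>0$ there is $E_\varepsilon\in\mathcal{A}$ with $\mu(E_\varepsilon)<\varepsilon$ such that $f_n\to f$ uniformly on $X\setminus E_\varepsilon$. Choquet integral: $\mathrm{Ch}(\mu,f):=\int_0^\infty\mu(\{f>t\})\,dt\in[0,\infty]$ (Lebesgue integral) for $f\in\mathcal{F}_0^+(X)$. For $a_n,a\in[-\infty,\infty]$, $a_n\uparrow a$ means that $\{a_n\}$ is nondecreasing and $a_n\to a$. The function $t\mapsto\mu(\{f>t\})$ is regarded as a function of $t\in\mathbb{R}$ with values in the extended half-line $[0,\infty]$. *)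

(* Defs.v *)
From mathcomp Require Export all_boot all_order all_algebra.
From mathcomp Require Export all_classical all_reals all_analysis.

Set Implicit Arguments.
Unset Strict Implicit.
Unset Printing Implicit Defensive.

Export Order.TTheory GRing.Theory Num.Theory.
Export numFieldNormedType.Exports.

#[global] Open Scope classical_set_scope.
#[global] Open Scope ring_scope.
#[global] Open Scope ereal_scope.

(* A set function is a total map [set T -> \bar R]; only its values on
   measurable sets are constrained or used below. *)
Definition nonadditive_measure (R : realType) (d : measure_display)
    (T : measurableType d) (mu : set T -> \bar R) : Prop :=
  [/\ mu set0 = 0,
      forall A, measurable A -> 0 <= mu A
    & forall A B, measurable A -> measurable B -> A `<=` B -> mu A <= mu B].

Definition monotone_autocontinuous_from_below (R : realType)
    (d : measure_display) (T : measurableType d) (mu : set T -> \bar R) : Prop :=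
  forall (A : set T) (B : (set T)^nat),
    measurable A -> (forall n, measurable (B n)) -> nonincreasing_seq B ->
    mu (B n) @[n --> \oo] --> 0 ->
    mu (A `\` B n) @[n --> \oo] --> mu A.

Definition cvg_in_measure (R : realType) (d : measure_display)
    (T : measurableType d) (mu : set T -> \bar R)
    (f_ : (T -> R)^nat) (f : T -> R) : Prop :=
  forall eps : R, (0 < eps)%R ->
    mu [set x | (eps < `|f_ n x - f x|)%R] @[n --> \oo] --> 0.

Definition cvg_almost_uniformly (R : realType) (d : measure_display)
    (T : measurableType d) (mu : set T -> \bar R)
    (f_ : (T -> R)^nat) (f : T -> R) : Prop :=
  forall eps : R, (0 < eps)%R ->
    exists E : set T,
      [/\ measurable E, mu E < eps%:E & {uniform ~` E, f_ @ \oo --> f}].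

(* The exceptional null set may depend on n; a countable union of null sets
   need not be null for a nonadditive measure. *)
Definition nondecreasing_below_ae (R : realType) (d : measure_display)
    (T : measurableType d) (mu : set T -> \bar R)
    (f_ : (T -> R)^nat) (f : T -> R) : Prop :=
  forall n, exists N : set T,
    [/\ measurable N, mu N = 0
      & forall x, ~ N x -> (f_ n x <= f_ n.+1 x)%R /\ (f_ n.+1 x <= f x)%R].

Definition increases_to (R : realType) (a_ : (\bar R)^nat) (a : \bar R) : Prop :=
  nondecreasing_seq a_ /\ a_ @ \oo --> a.

Definition decreasing_distribution (R : realType) (d : measure_display)
    (T : measurableType d) (mu : set T -> \bar R) (f : T -> R) : R -> \bar R :=
  fun t => mu [set x | (t < f x)%R].

Definition Choquet (R : realType) (d : measure_display)
    (T : measurableType d) (mu : set T -> \bar R) (f : T -> R) : \bar R :=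
  \int[lebesgue_measure]_(t in `[0%R, +oo[) decreasing_distribution mu f t.

(* Main.v *)
(* Condition (a) with autocontinuity (which makes null sets negligible) gives
   [mu {f_n > t} <= mu {f_(n+1) > t} <= mu {f > t}], and since
   [{f > s}] minus [{|f_n - f| > s - t}] lies in [{f_n > t}], convergence in
   measure gives [mu {f > s} <= sup_n mu {f_n > t}] for all [t < s]. Letting
   [s] decrease to [t] yields (ii). For (iii), the supremum and
   [t |-> mu {f > t}] then differ at countably many [t] only, so monotone
   convergence applies. Conversely (i) follows from (ii) or (iii) applied to
   the indicators of [A `\` B_n] and [A]. *)
Require Import Defs.
From mathcomp Require Import measurable_realfun lra.

Set Implicit Arguments.
Unset Strict Implicit.
Unset Printing Implicit Defensive.

(** * Nonincreasing extended-real functions and their integrals *)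

Lemma lte_exists_rat (R : realType) (x y : \bar R) :
  0 <= x -> x < y -> exists q : rat, x < (ratr q)%:E < y.
Proof.
case: x => [r||] // _; case: y => [s||] //.
- rewrite lte_fin => /rat_in_itvoo[q]; rewrite in_itv/= => rqs.
  by exists q; rewrite !lte_fin.
- move=> _; have /rat_in_itvoo[q] : (r < r + 1)%R by rewrite ltrDl.
  by rewrite in_itv/= => /andP[rq _]; exists q; rewrite lte_fin rq ltry.
Qed.

(** Closed upper rays generate the Borel sets of [\bar R], and the preimage of such a ray under a
    nonincreasing function is an interval. *)
Lemma nonincreasing_emeasurable (R : realType) (D : set R) (g : R -> \bar R) :
  measurable D -> {homo g : x y / (x <= y)%R >-> y <= x} ->
  measurable_fun D g.
Proof.
move=> mD g_ni.
apply: (measurability (@ErealGenCInfty.G R)).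
  exact: ErealGenCInfty.measurableE.
move=> _ [_ [r ->] <-]; apply: measurableI => //.
apply: is_interval_measurable => s t /=.
rewrite !in_itv/= !andbT => rs rt u /andP[su ut].
by rewrite in_itv/= andbT (le_trans rt)// g_ni.
Qed.

(* Whenever [h t < g t], pick a rational in between: since [g <= h] strictly
   to the left, distinct points receive distinct rationals. *)
Lemma countable_lt_nonincreasing (R : realType) (D : set R)
    (h g : R -> \bar R) :
  (forall t, D t -> 0 <= h t) ->
  (forall s t, D s -> D t -> (s < t)%R -> g t <= h s) ->
  countable [set t | D t /\ h t < g t].
Proof.
move=> h0 gh.
have -> : [set t | D t /\ h t < g t] = \bigcup_(q in [set: rat])
    [set t | D t /\ h t < (ratr q)%:E < g t].
  apply/seteqP; split=> t /=; last first.
    by move=> [q _ [Dt /andP[hq qg]]]; split => //; exact: lt_trans qg.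
  move=> [Dt hg]; have [q hqg] := lte_exists_rat (h0 _ Dt) hg.
  by exists q.
apply: bigcup_countable => // q _; apply/countable_injP.
exists (fun=> 0%N) => s t /set_mem[Ds /andP[hs gs]] /set_mem[Dt /andP[ht gt]] _.
have [st|ts|//] := ltgtP s t.
- by have := lt_trans (lt_le_trans gt (gh _ _ Ds Dt st)) hs; rewrite ltxx.
- by have := lt_trans (lt_le_trans gs (gh _ _ Dt Ds ts)) ht; rewrite ltxx.
Qed.

Lemma increases_to_integral (R : realType) (D : set R)
    (g_ : (R -> \bar R)^nat) (g : R -> \bar R) :
  measurable D ->
  (forall n, {homo g_ n : x y / (x <= y)%R >-> y <= x}) ->
  {homo g : x y / (x <= y)%R >-> y <= x} ->
  (forall n t, 0 <= g_ n t) ->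
  (forall n t, D t -> g_ n t <= g_ n.+1 t) ->
  (forall n t, D t -> g_ n t <= g t) ->
  (forall s t, D s -> D t -> (s < t)%R ->
    g t <= ereal_sup (range (g_ ^~ s))) ->
  increases_to (fun n => \int[lebesgue_measure]_(t in D) g_ n t)
    (\int[lebesgue_measure]_(t in D) g t).
Proof.
move=> mD g_ni gni g_0 g_S g_g gsup.
have mg_ n : measurable_fun D (g_ n) by exact: nonincreasing_emeasurable.
have mg : measurable_fun D g by exact: nonincreasing_emeasurable.
have g_nd t : D t -> {homo g_^~ t : n m / (n <= m)%N >-> n <= m}.
  by move=> Dt; apply/nondecreasing_seqP => n; exact: g_S.
have g0 t : D t -> 0 <= g t by move=> Dt; exact: le_trans (g_g 0%N _ Dt).
split.
  apply/nondecreasing_seqP => n; apply: ge0_le_integral => //.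
  - exact: mg_.
  - exact: mg_.
  - by move=> t Dt; exact: g_S.
have limE t : D t -> limn (g_^~ t) = ereal_sup (range (g_^~ t)).
  move=> Dt; apply/cvg_lim => //; apply: ereal_nondecreasing_cvgn.
  exact: g_nd.
(* The pointwise limit is at most [g] but dominates its values strictly to the right, so it differs
   from [g] on a countable, hence Lebesgue-null, set. *)
have -> : \int[lebesgue_measure]_(t in D) g t =
    \int[lebesgue_measure]_(t in D) limn (g_^~ t).
  apply: ge0_ae_eq_integral => //.
  - apply: (emeasurable_fun_cvg g_) => // t Dt.
    by rewrite limE//; apply: ereal_nondecreasing_cvgn; exact: g_nd.
  - move=> t Dt; rewrite limE//; apply: le_trans (g_0 0%N t) _.
    by apply: ereal_sup_ubound; exists 0%N.
  have cD : countable [set t | D t /\ ereal_sup (range (g_^~ t)) < g t].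
    apply: countable_lt_nonincreasing => // t Dt.
    apply: le_trans (g_0 0%N t) _.
    by apply: ereal_sup_ubound; exists 0%N.
  exists [set t | D t /\ ereal_sup (range (g_^~ t)) < g t]; split => /=.
  - by apply: countable_measurable => // t; exact: measurable_set1.
  - exact: countable_lebesgue_measure0.
  - move=> t /= /not_implyP[Dt] /eqP; rewrite limE// => neq; split => //.
    rewrite lt_neqAle eq_sym neq/=; apply: ge_ereal_sup => _ [n _ <-].
    exact: g_g.
exact: cvg_monotone_convergence.
Qed.

Lemma powR_gt_level (R : realType) (q t x : R) : (0 < q)%R -> (0 <= t)%R ->
  (0 <= x)%R -> (t < x `^ q)%R = (t `^ q^-1 < x)%R.
Proof.
move=> q0 t0 x0.
have u0 : (0 <= t `^ q^-1)%R := powR_ge0 _ _.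
have <- : ((t `^ q^-1) `^ q)%R = t by rewrite -powRrM mulVf ?gt_eqF// powRr1.
rewrite -[in RHS]powRrM mulfV ?gt_eqF// powRr1//.
apply/idP/idP; last exact: gt0_ltr_powR.
by rewrite !ltNge; apply: contra; apply: ge0_ler_powR => //; exact: ltW.
Qed.

(** Lets bounds on the level sets of [f] pass to its [q]-th power without a change of variables in
    the Choquet integral. *)
Lemma level_powR (R : realType) (T : Type) (f : T -> R) (q t : R) :
  (0 < q)%R -> (forall x, (0 <= f x)%R) -> (0 <= t)%R ->
  [set x | (t < f x `^ q)%R] = [set x | (t `^ q^-1 < f x)%R].
Proof.
by move=> q0 f0 t0; apply/seteqP; split => x /=; rewrite powR_gt_level.
Qed.

(** * Level sets and modes of convergence for a nonadditive measure *)

Section nonadditive.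
Context (R : realType) (d : measure_display) (T : measurableType d).
Variable mu : set T -> \bar R.
Hypothesis mu_na : nonadditive_measure mu.

Let mu0 : mu set0 = 0. Proof. by case: mu_na. Qed.
Let mu_ge0 A : measurable A -> 0 <= mu A.
Proof. by case: mu_na => _ + _; apply. Qed.
Let mu_le A B : measurable A -> measurable B -> A `<=` B -> mu A <= mu B.
Proof. by case: mu_na => _ _; apply. Qed.

Lemma measurable_gt_level (f : T -> R) t : measurable_fun [set: T] f ->
  measurable [set x | (t < f x)%R].
Proof.
move=> mf; have := mf measurableT `]t, +oo[%classic (measurable_itv _).
rewrite setTI; congr measurable; apply/seteqP.
by split=> x /=; rewrite in_itv/= andbT.
Qed.

Lemma measurable_dist_level (f g : T -> R) t : measurable_fun [set: T] f ->
  measurable_fun [set: T] g -> measurable [set x | (t < `|f x - g x|)%R].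
Proof.
move=> mf mg; apply: (@measurable_gt_level (fun x => `|f x - g x|%R)).
by apply: measurableT_comp => //; exact: measurable_funB.
Qed.

Lemma decreasing_distribution_ni (f : T -> R) : measurable_fun [set: T] f ->
  {homo decreasing_distribution mu f : s t / (s <= t)%R >-> t <= s}.
Proof.
move=> mf s t st; apply: mu_le; [exact: measurable_gt_level..|].
by move=> x /=; exact: le_lt_trans.
Qed.

(** Uniform convergence off [E] eventually forces the deviation set into [E], whose measure is as
    small as desired; monotonicity of [mu] concludes. *)
Lemma cvg_almost_uniformly_in_measure (f_ : (T -> R)^nat) (f : T -> R) :
  (forall n, measurable_fun [set: T] (f_ n)) -> measurable_fun [set: T] f ->
  cvg_almost_uniformly mu f_ f -> cvg_in_measure mu f_ f.
Proof.
move=> mf_ mf au e e0.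
have small r : (0 < r)%R ->
    \forall n \near \oo, mu [set x | (e < `|f_ n x - f x|)%R] < r%:E.
  move=> r0; have [E [mE Er ufE]] := au r r0.
  have H : nbhs (f : {uniform` ~` E -> R})
      [set h | forall y, (~` E) y -> ball (f y) e (h y)].
    apply/uniform_nbhs; exists [set xy | ball xy.1 e xy.2]; split => //.
    exact: entourage_ball (PosNum e0).
  have {}H := ufE _ H.
  near=> n; apply: le_lt_trans Er; apply: mu_le => //.
    exact: measurable_dist_level.
  move=> x /= ex; apply: contrapT => Ex.
  have : ball (f x) e (f_ n x) by move: x Ex {ex}; near: n.
  by rewrite /ball/= distrC ltNge (ltW ex).
(* Convergence to 0 in [\bar R] splits into eventual finiteness, from the bound 1, and convergence
   of the real parts. *)
apply/fine_cvgP; split.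
  apply: filterS (small 1%R ltr01) => n lt1.
  rewrite ge0_fin_numE ?(lt_trans lt1) ?ltry//.
  by apply: mu_ge0; exact: measurable_dist_level.
apply/cvgr0Pnorm_lt => r r0; apply: filterS (small r r0) => n lt1 /=.
have ge0 : 0 <= mu [set x | (e < `|f_ n x - f x|)%R].
  by apply: mu_ge0; exact: measurable_dist_level.
rewrite ger0_norm ?fine_ge0// -lte_fin fineK//.
by rewrite ge0_fin_numE// (lt_trans lt1) ?ltry.
Unshelve. all: by end_near. Qed.

(** * Null sets and distributions under autocontinuity *)

Section autocontinuous.
Hypothesis mu_ac : monotone_autocontinuous_from_below mu.

(** Autocontinuity is applied to the constant sequence [N]. *)
Lemma null_setD A N : measurable A -> measurable N -> mu N = 0 ->
  mu (A `\` N) = mu A.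
Proof.
move=> mA mN N0.
have /cvg_lim <- // : mu (A `\` N) @[_ --> \oo] --> mu A.
  by apply: (mu_ac (B := fun=> N)) => //; rewrite N0; exact: cvg_cst.
by rewrite lim_cst.
Qed.

Lemma null_setU_le A B N : measurable A -> measurable B -> measurable N ->
  mu N = 0 -> A `<=` B `|` N -> mu A <= mu B.
Proof.
move=> mA mB mN N0 AB; rewrite -(null_setD mA mN N0).
by apply: mu_le => //; [exact: measurableD|move=> x [/AB[]]].
Qed.

(** By induction: adjoining one null set does not raise the measure. *)
Lemma null_bigcup n (N : (set T)^nat) : (forall k, measurable (N k)) ->
  (forall k, mu (N k) = 0) -> mu (\bigcup_(k < n) N k) = 0.
Proof.
move=> mN N0; elim: n => [|n IH]; first by rewrite bigcup_mkord big_ord0.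
have mU m : measurable (\bigcup_(k < m) N k) by exact: bigcup_measurable.
apply/eqP; rewrite eq_le mu_ge0// andbT -IH.
apply: (null_setU_le _ _ (mN n)) => //.
by rewrite !bigcup_mkord big_ord_recr.
Qed.

Variables (f_ : (T -> R)^nat) (f : T -> R).
Hypothesis mf_ : forall n, measurable_fun [set: T] (f_ n).
Hypothesis mf : measurable_fun [set: T] f.
Hypothesis f_f : nondecreasing_below_ae mu f_ f.

Lemma distribution_le_succ t n :
  mu [set x | (t < f_ n x)%R] <= mu [set x | (t < f_ n.+1 x)%R].
Proof.
have [N [mN N0 fN]] := f_f n.
apply: (null_setU_le _ _ mN) => //; [exact: measurable_gt_level..|].
move=> x /= tx; have [Nx|/fN[le1 _]] := pselect (N x); first by right.
by left; exact: lt_le_trans le1.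
Qed.

Lemma distribution_le_limit t n :
  mu [set x | (t < f_ n x)%R] <= mu [set x | (t < f x)%R].
Proof.
have [N [mN N0 fN]] := f_f n.
apply: (null_setU_le _ _ mN) => //; [exact: measurable_gt_level..|].
move=> x /= tx; have [Nx|/fN[le1 le2]] := pselect (N x); first by right.
by left; exact: lt_le_trans (le_trans le1 le2).
Qed.

Hypothesis cvgf : cvg_in_measure mu f_ f.

(* The deviation sets [E n] decrease only up to null sets, so autocontinuity is
   applied to [B n], the intersection of the first [n + 1] of them, which
   differs from [E n] by a finite union of null sets. *)
Lemma distribution_le_sup s t : (t < s)%R ->
  mu [set x | (s < f x)%R] <=
    ereal_sup (range (fun n => mu [set x | (t < f_ n x)%R])).
Proof.
move=> ts; set e := (s - t)%R.
have e0 : (0 < e)%R by rewrite subr_gt0.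
pose E n := [set x | (e < `|f_ n x - f x|)%R].
have mE n : measurable (E n) by exact: measurable_dist_level.
pose B n := \bigcap_(k < n.+1) E k.
have mB n : measurable (B n) by exact: bigcap_measurableType.
have BE n : B n `<=` E n by move=> x; apply; exact: ltnSn.
have Bni : nonincreasing_seq B.
  apply/nonincreasing_seqP => n; apply/subsetPset => x Bx k /= kn.
  by apply: Bx => /=; exact: leqW.
have B0 : mu (B n) @[n --> \oo] --> 0.
  apply: (squeeze_cvge _ (cvg_cst 0) (cvgf e0)).
  by apply: nearW => n; rewrite mu_ge0//=; exact: mu_le (mB n) (mE n) (BE n).
set A := [set x | (s < f x)%R].
have mA : measurable A by exact: measurable_gt_level.
have [N NP] := choice f_f.
have mN n : measurable (N n) by have [] := NP n.
have N0 n : mu (N n) = 0 by have [] := NP n.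
apply: (cvge_to_le (mu_ac mA mB Bni B0)); near=> n.
apply: (@le_trans _ _ (mu [set x | (t < f_ n x)%R])); last first.
  by apply: ereal_sup_ubound; exists n.
apply: (null_setU_le _ _ _ (null_bigcup n.+1 mN N0)).
- exact: measurableD.
- exact: measurable_gt_level.
- exact: bigcup_measurable.
move=> x [/= sx nBx].
have [Nx|nNx] := pselect ((\bigcup_(k < n.+1) N k) x); first by right.
left => /=.
have step k : (k <= n)%N -> (f_ k x <= f_ k.+1 x <= f x)%R.
  move=> kn; have [_ _ H] := NP k; apply/andP/H => Nk.
  by apply: nNx; exists k.
(* Off the discarded null sets, [f_ k x] increases with [k] up to [n] and stays below [f x]. The
   deviation thus shrinks, and a point of [E n] would lie in every earlier [E k], hence in [B n]. *)
have nEx : ~ E n x.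
  move=> En; apply: nBx => k; rewrite /= ltnS => kn.
  have le_k m : (k <= m <= n)%N -> (f_ k x <= f_ m x)%R.
    elim: m => [|m IH]; first by rewrite leqn0 => /andP[/eqP->].
    rewrite leq_eqVlt ltnS => /andP[/predU1P[->//|km] mn].
    have /andP[le1 _] := step m (ltnW mn).
    by rewrite (le_trans _ le1)// IH// km ltnW.
  have le_kn : (f_ k x <= f_ n x)%R by rewrite le_k// kn leqnn.
  apply: lt_le_trans En _.
  have /andP[l1 l2] := step n (leqnn n).
  have lnf := le_trans l1 l2.
  have lkf := le_trans le_kn lnf.
  by rewrite !ler0_norm ?subr_le0// lerN2 lerD2r.
move/negP: nEx; rewrite -leNgt /e ler_norml => /andP[+ _].
by move: sx; rewrite /A/=; lra.
Unshelve. all: by end_near. Qed.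

End autocontinuous.

(** * Indicators as test functions *)

Lemma level_indic (A : set T) t : (0 <= t < 1)%R ->
  [set x | (t < \1_A x :> R)%R] = A.
Proof.
move=> /andP[t0 t1]; apply/seteqP; split => x /=; rewrite indicE.
  by case: (boolP (x \in A)) => [/set_mem//|_] /=; rewrite ltNge t0.
by move=> /mem_set ->.
Qed.

(** The level set is [A] for [t] in [[0, 1[] and empty from 1 on, so the integrand is [mu A] times
    the indicator of an interval of length 1. *)
Lemma integral_distribution_indic A : measurable A ->
  \int[lebesgue_measure]_(t in `[0%R, +oo[) mu [set x | (t < \1_A x :> R)%R]
    = mu A.
Proof.
move=> mA.
transitivity (\int[lebesgue_measure]_(t in `[0%R, +oo[)
    (mu A * (\1_(`[0%R, 1%R[ : set R) t)%:E)).
  apply: eq_integral => t; rewrite inE/= in_itv/= andbT => t0.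
  rewrite indicE mem_setE in_itv/= t0/=; case: ltP => t1.
    by rewrite mule1 level_indic// t0.
  rewrite mule0 (_ : [set _ | _] = set0)// -subset0 => x /=.
  by rewrite indicE ltNge (le_trans _ t1)// lern1 leq_b1.
have mI : measurable (`[0%R, 1%R[%classic : set R).
  exact: (@measurable_itv R).
rewrite ge0_integralZl//.
- rewrite integral_indic// setIidl; last first.
    by move=> t /=; rewrite !in_itv/= andbT => /andP[].
  have l1 : lebesgue_measure (`[0%R, 1%R[%classic : set R) = 1.
    by rewrite lebesgue_measure_itv/= lte_fin ltr01 sube0.
  by rewrite [X in _ * X]l1 mule1.
- by apply/measurable_EFinP; exact: measurable_indic.
- exact: mu_ge0.
Qed.

Lemma nondecreasing_below_ae_indic (A : set T) (B : (set T)^nat) :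
  nonincreasing_seq B ->
  nondecreasing_below_ae mu (fun n => \1_(A `\` B n) : T -> R) (\1_A).
Proof.
move=> Bni n; exists set0; split => //.
have ind (C D : set T) x : C `<=` D -> (\1_C x <= \1_D x :> R)%R.
  move=> CD; rewrite !indicE ler_nat.
  by case: (boolP (x \in C)) => // /set_mem/CD/mem_set->.
move=> x _; split; apply: ind.
- by apply: setDS; apply/subsetPset/Bni.
- exact: subDsetl.
Qed.

Lemma indic_setD_notin (A B : set T) x : ~ B x ->
  \1_(A `\` B) x = \1_A x :> R.
Proof. by move=> Bx; rewrite !indicE in_setD (memNset Bx) andbT. Qed.

Lemma indic_setD_dist (A B : set T) e : (0 < e)%R ->
  [set x | (e < `|\1_(A `\` B) x - \1_A x : R|)%R] `<=` B.
Proof.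
move=> e0 x /=; apply: contraPP => Bx.
by rewrite indic_setD_notin// subrr normr0 => /(lt_trans e0); rewrite ltxx.
Qed.

End nonadditive.

(** * The cycle of implications *)

Theorem proposition6p3 (R : realType) (d : measure_display)
    (T : measurableType d) (mu : set T -> \bar R)
    (mu_nonadditive : nonadditive_measure mu) (q : R) (q_gt0 : (0 < q)%R) :
  [<-> monotone_autocontinuous_from_below mu;
       forall (f_ : (T -> R)^nat) (f : T -> R),
         (forall n, measurable_fun [set: T] (f_ n)) ->
         measurable_fun [set: T] f ->
         nondecreasing_below_ae mu f_ f ->
         cvg_in_measure mu f_ f ->
         forall t : R, continuous_at t (decreasing_distribution mu f) ->
           increases_to (fun n => mu [set x | (t < f_ n x)%R])
                        (mu [set x | (t < f x)%R]);
       forall (f_ : (T -> R)^nat) (f : T -> R),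
         (forall n, measurable_fun [set: T] (f_ n)) ->
         (forall n x, (0 <= f_ n x)%R) ->
         measurable_fun [set: T] f ->
         (forall x, (0 <= f x)%R) ->
         nondecreasing_below_ae mu f_ f ->
         cvg_almost_uniformly mu f_ f ->
         increases_to (fun n => Choquet mu (fun x => (f_ n x `^ q)%R))
                      (Choquet mu (fun x => (f x `^ q)%R))].
Proof.
have [_ mu_ge0 mu_le] := mu_nonadditive.
tfae.
- move=> ac f_ f mf_ mf f_f cvgf t ct.
  have nd : nondecreasing_seq (fun n => mu [set x | (t < f_ n x)%R]).
    apply/nondecreasing_seqP => n.
    exact: (distribution_le_succ mu_nonadditive ac mf_ f_f).
  split => //.
  rewrite (_ : mu _ = ereal_sup (range (fun n => mu [set x | (t < f_ n x)%R]))).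
    exact: ereal_nondecreasing_cvgn.
  apply/eqP; rewrite eq_le; apply/andP; split; last first.
    apply: ge_ereal_sup => _ [n _ <-].
    exact: (distribution_le_limit mu_nonadditive ac mf_ mf f_f).
  (* By continuity at [t], [mu {f > t}] is the limit of [mu {f > s}] as [s] decreases to [t], and
     each of these is at most the supremum. *)
  apply: (cvge_to_le (cvg_at_right_filter ct)).
  near=> s; exact: (distribution_le_sup mu_nonadditive ac mf_ mf f_f cvgf).
- move=> H f_ f mf_ f_0 mf f0 f_f
    /(cvg_almost_uniformly_in_measure mu_nonadditive mf_ mf) cvgf.
  (* Autocontinuity is first recovered from (ii), with indicators at level 1/2; the integrals are
     then treated using autocontinuity. *)
  have ac : monotone_autocontinuous_from_below mu.
    move=> A B mA mB Bni B0.
    have half : (0 <= (2^-1 : R) < 1)%R.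
      by rewrite invr_ge0 ler0n invf_lt1 ?ltr1n ?ltr0n.
    have [] := H (fun n => \1_(A `\` B n)) (\1_A) _ _ _ _ 2^-1%R.
    + by move=> n; apply: measurable_indic; exact: measurableD.
    + exact: measurable_indic.
    + exact: nondecreasing_below_ae_indic.
    + move=> e e0; apply: (squeeze_cvge _ (cvg_cst 0) B0); near=> n.
      have mD : measurable [set x | (e < `|\1_(A `\` B n) x - \1_A x : R|)%R].
        apply: measurable_dist_level; apply: measurable_indic => //.
        exact: measurableD.
      by rewrite mu_ge0//= mu_le//; exact: indic_setD_dist.
    (* The distribution of the indicator of [A] is constantly [mu A] on []0, 1[], a neighbourhood of
       1/2. *)
    + rewrite /continuous_at; apply: cvg_near_cst.
      near=> t; rewrite /decreasing_distribution !level_indic//.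
      suff : t \in `]0%R, 1%R[ by rewrite in_itv/= => /andP[/ltW-> ->].
      by near: t; apply: near_in_itvoo;
        rewrite in_itv/= invr_gt0 invf_lt1 ?ltr1n ?ltr0n.
    by move=> _; rewrite level_indic//; under eq_fun do rewrite level_indic//.
  pose D := `[0%R, +oo[%classic : set R.
  have D0 t : D t -> (0 <= t)%R by rewrite /D/= in_itv/= andbT.
  have mD : measurable D by exact: (@measurable_itv R).
  have mpow (h : T -> R) : measurable_fun [set: T] h ->
      measurable_fun [set: T] (fun x => h x `^ q)%R.
    by move=> mh; exact: (measurableT_comp (measurable_powR q) mh).
  apply: (increases_to_integral mD).
  + by move=> n; apply: decreasing_distribution_ni => //; exact: mpow.
  + by apply: decreasing_distribution_ni => //; exact: mpow.
  + by move=> n t; apply: mu_ge0; apply: measurable_gt_level; exact: mpow.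
  + move=> n t /D0 t0; rewrite /decreasing_distribution !level_powR//.
    exact: (distribution_le_succ mu_nonadditive ac mf_ f_f).
  + move=> n t /D0 t0; rewrite /decreasing_distribution !level_powR//.
    exact: (distribution_le_limit mu_nonadditive ac mf_ mf f_f).
  (* The [q]-th root is strictly increasing, so [s < t] still leaves a gap between the two levels
     for [f]. *)
  + move=> s t /D0 s0 /D0 t0 st; rewrite /decreasing_distribution level_powR//.
    rewrite [X in range X](_ : _ =
        fun n => mu [set x | (s `^ q^-1 < f_ n x)%R]).
      apply: (distribution_le_sup mu_nonadditive ac mf_ mf f_f cvgf).
      by apply: gt0_ltr_powR; rewrite ?invr_gt0 ?nnegrE.
    by apply/funext => n; rewrite level_powR.
- move=> H A B mA mB Bni B0.
  have mAB n : measurable (A `\` B n) by exact: measurableD.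
  have powI (C : set T) : (fun x => \1_C x `^ q)%R = (\1_C : T -> R).
    apply/funext => x; rewrite indicE.
    by case: (x \in C); rewrite ?powR1// powR0// gt_eqF.
  have [] := H (fun n => \1_(A `\` B n)) (\1_A).
  + by move=> n; exact: measurable_indic.
  + by [].
  + exact: measurable_indic.
  + by [].
  + exact: nondecreasing_below_ae_indic.
  (* The exceptional set is some [B n] of measure below [e]: for [m >= n], [B m] lies in [B n], so
     off [B n] the two indicators coincide. *)
  + move=> e e0.
    have : \forall n \near \oo, mu (B n) < e%:E.
      apply: (B0 [set x | x < e%:E]); apply: open_nbhs_nbhs; split => //=.
      exact: open_ereal_lt_ereal.
    move=> [n _ /(_ n (leqnn n)) Bne]; exists (B n); split => //.
    move=> P /uniform_nbhs[W [entW WP]]; exists n => // m /= nm.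
    apply: WP => x nBx /=; rewrite indic_setD_notin.
      exact: entourage_refl.
    by move/(subsetPset _ _ (Bni _ _ nm)).
  move=> _; under eq_fun do rewrite powI.
  rewrite powI /Choquet (integral_distribution_indic mu_nonadditive mA).
  by under eq_fun do rewrite (integral_distribution_indic mu_nonadditive (mAB _)).
Unshelve. all: by end_near. Qed.
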